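(* Let $|q|<1$ and define integers $u_n,v_n$ by $$\sum_{n=0}^{\infty}u_nq^n=(q,q^4;q^5)_\infty^3(q^3,q^7;q^{10})_\infty,\qquad \sum_{n=0}^{\infty}v_nq^n=(q^2,q^3;q^5)_\infty^3(q,q^9;q^{10})_\infty.$$ Then $u_{5n+4}=0$ and $v_{5n+3}=0$ for all $n\ge0$.
   Context: For complex $a$ and $|q|<1$, $(a;q)_\infty=\prod_{k=0}^{\infty}(1-aq^k)$ and $(a_1,\dots,a_m;q)_\infty=(a_1;q)_\infty\cdots(a_m;q)_\infty$. *)

(* Defs.v *)
From HB Require Import structures.
From mathcomp Require Export all_boot all_order all_algebra.
From mathcomp Require Export complex.
From mathcomp Require Export all_classical all_reals all_analysis.

Export Order.TTheory GRing.Theory Num.Theory.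
Export numFieldNormedType.Exports.

Set Implicit Arguments.
Unset Strict Implicit.
Unset Printing Implicit Defensive.

Local Open Scope classical_set_scope.
Local Open Scope ring_scope.

(* The carrier is given the [numClosedFieldType] view of [R[i]] so that the
   topology is the one induced by the complex modulus. *)
Definition cplx (R : realType) : numClosedFieldType := R[i]%C.

(* (a; q)_oo; the partial products converge whenever `|q| < 1, and the value
   of [lim] is only meaningful in that case. *)
Definition qpoch (R : realType) (a q : cplx R) : cplx R :=
  lim ((fun n : nat => \prod_(k < n) (1 - a * q ^+ k)) @ \oo).

(* (a_1, ..., a_m; q)_oo *)
Definition qpochs (R : realType) (s : seq (cplx R)) (q : cplx R) : cplx R :=
  \prod_(a <- s) qpoch a q.

(* sum_{n >= 0} c_n q^n = f(q), as a convergent series, on |q| < 1 *)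
Definition has_qexpansion (R : realType) (c : nat -> int)
    (f : cplx R -> cplx R) : Prop :=
  forall q : cplx R, `|q| < 1 ->
    series (fun n : nat => (c n)%:~R * q ^+ n) @ \oo --> f q.

(* Main.v *)
From HB Require Import structures.
Require Import Defs.
From mathcomp Require Import zify ring lra.

Set Implicit Arguments.
Unset Strict Implicit.
Unset Printing Implicit Defensive.

Local Open Scope ring_scope.

(** By the Jacobi triple product, multiplying the generating function of [u]
    (resp. [v]) by a power series in [q^5] turns it into a fourfold theta series
      sum (-1)^(x+y+z+d) q^Q(x,y,z,d),
      Q = sum_(t = x,y,z) (5 t(t-1)/2 + a t) + 5 d(d-1) + (5-2a) d,
    with a = 1 (resp. a = 2).  An exponent congruent to [-a] modulo 5 forces
    x + y + z - 2d = 5K - 1, and on these points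
      (x,y,z,d) |-> (2K-x, 2K-y, 2K-z, 1-2K-d)
    is an involution which preserves Q and reverses the sign, so all terms cancel.

    The triple product is used modulo powers of [X] in Z[X], where it follows
    from the finite q-binomial theorem.  The coefficients of the analytic
    expansions are those of the truncated products because, for small real
    [r > 0], the limit differs from the [N]-th truncation by [O(r^N)]. *)

(** * Gaussian binomials and the finite q-binomial theorem *)

Section QBinomial.
Variables (A : comNzRingType) (q : A).

Definition qfact n : A := \prod_(i < n) (1 - q ^+ i.+1).

(** The Gaussian binomial, defined by a q-Pascal rule so that no division occurs in [A]. Where
    [n' - k'] truncates, the factor [gauss n' k'] is 0. *)
Fixpoint gauss (n k : nat) : A :=
  match n, k with
  | _, 0 => 1
  | 0, _.+1 => 0
  | n'.+1, k'.+1 => gauss n' k'.+1 + q ^+ (n' - k') * gauss n' k'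
  end.

Lemma qfactS n : qfact n.+1 = qfact n * (1 - q ^+ n.+1).
Proof. by rewrite /qfact big_ord_recr. Qed.

Lemma gauss0 n : gauss n 0 = 1.
Proof. by case: n. Qed.

Lemma gaussS n k :
  gauss n.+1 k.+1 = gauss n k.+1 + q ^+ (n - k) * gauss n k.
Proof. by []. Qed.

Lemma gauss_small n k : (n < k)%N -> gauss n k = 0.
Proof.
elim: n k => [|n IHn] [|k] //; rewrite ltnS => ltnk.
by rewrite gaussS !IHn ?mulr0 ?addr0 // ltnW.
Qed.

Lemma gauss_qfact n k : (k <= n)%N ->
  gauss n k * qfact k * qfact (n - k) = qfact n.
Proof.
elim: n k => [|n IHn] [|k] //.
- by rewrite /= /qfact big_ord0 !mulr1.
- by move=> _; rewrite gauss0 subn0 {1}/qfact big_ord0 !mul1r.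
rewrite ltnS subSS gaussS leq_eqVlt => /orP[/eqP->|ltkn].
  rewrite (@gauss_small n n.+1) // subnn expr0 qfactS -[in RHS](IHn n) // subnn.
  by ring.
have := IHn _ ltkn; have := IHn _ (ltnW ltkn).
have -> : (n - k = (n - k.+1).+1)%N by lia.
rewrite !qfactS => E1 E2.
have -> : q ^+ n.+1 = q ^+ (n - k.+1).+1 * q ^+ k.+1.
  by rewrite -exprD; congr (_ ^+ _); lia.
set s := q ^+ (n - k.+1).+1 in E1 E2 *; set t := q ^+ k.+1 in E1 E2 *.
transitivity (gauss n k.+1 * (qfact k * (1 - t)) * qfact (n - k.+1) * (1 - s)
  + s * (1 - t) * (gauss n k * qfact k * (qfact (n - k.+1) * (1 - s)))).
  by ring.
by rewrite E1 E2; ring.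
Qed.

(** The homogeneous form in [x] and [y] avoids negative powers of [X] when the triple product is
    centred at [k = N]. *)
Lemma qbinomial (x y : A) n :
  \prod_(i < n) (y + x * q ^+ i) =
  \sum_(k < n.+1) gauss n k * q ^+ 'C(k, 2) * x ^+ k * y ^+ (n - k).
Proof.
elim: n => [|n IHn].
  by rewrite big_ord0 big_ord_recl big_ord0 /= addr0 !expr0 !mulr1.
rewrite big_ord_recr /= IHn mulrDr.
have Ey : (\sum_(k < n.+1) gauss n k * q ^+ 'C(k, 2) * x ^+ k * y ^+ (n - k)) * y
   = \sum_(k < n.+2) gauss n k * q ^+ 'C(k, 2) * x ^+ k * y ^+ (n.+1 - k).
  rewrite [RHS]big_ord_recr /= gauss_small // !mul0r addr0 mulr_suml.
  apply: eq_bigr => k _; rewrite -mulrA -exprSr subSn //.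
  by rewrite -ltnS.
rewrite {}Ey big_ord_recl [RHS]big_ord_recl !gauss0 -addrA; congr (_ + _).
rewrite mulr_suml -big_split /=; apply: eq_bigr => k _.
rewrite /bump /= !add1n subSS.
have lekn : (k <= n)%N by rewrite -ltnS.
have En : q ^+ n = q ^+ (n - k) * q ^+ k by rewrite -exprD subnK.
by rewrite En binS bin1 exprD exprS; ring.
Qed.

End QBinomial.

(** * The finite Jacobi triple product *)

Definition jprod (c a N : nat) : {poly int} :=
  \prod_(k < N) ((1 - 'X^(c * k + a)) * (1 - 'X^(c * k + (c - a)))).

(** Degree of the monomial extracted from the [2N] factors: the sum of [a + c i] over [i < N], plus
    [N] times [c N]. *)
Definition jshift (c a N : nat) : nat := (c * (N * N + 'C(N, 2)) + a * N)%N.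

(* The exponent c j(j-1)/2 + a j of the theta series, for j = k - N; the
   subtraction does not truncate when 0 < a < c and k <= 2N (jexpK, jexpE). *)
Definition jexp (c a N k : nat) : nat :=
  (c * 'C(k, 2) + c * N * (2 * N - k) + a * k - jshift c a N)%N.

Definition theta (c a N : nat) : {poly int} :=
  \sum_(k < (2 * N).+1) (-1) ^+ (N + k) * 'X^(jexp c a N k).

Lemma bin2Z n : 2 * ('C(n, 2)%:Z) = n%:Z * (n%:Z - 1).
Proof.
elim: n => [|n IHn]; first by [].
by rewrite binS bin1 PoszD mulrDr IHn; lia.
Qed.

Lemma jexp_raw (c a N k : nat) : (k <= 2 * N)%N ->
  2 * ((c * 'C(k, 2) + c * N * (2 * N - k) + a * k)%N%:Z - (jshift c a N)%:Z)
  = c%:Z * ((k%:Z - N%:Z) * (k%:Z - N%:Z - 1)) + 2 * a%:Z * (k%:Z - N%:Z).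
Proof.
move=> lek; rewrite /jshift !PoszD !PoszM -!subzn // !PoszD !PoszM.
have E1 := bin2Z k; have E2 := bin2Z N.
transitivity (c%:Z * (2 * 'C(k, 2)%:Z) + 2 * c%:Z * N%:Z * (2 * N%:Z - k%:Z)
   + 2 * a%:Z * k%:Z - (c%:Z * (2 * N%:Z * N%:Z + 2 * 'C(N, 2)%:Z) + 2 * a%:Z * N%:Z)).
  by ring.
by rewrite E1 E2; ring.
Qed.

(** For [j < 0], put [i = -j]: the right side is [c i (i - 1) + 2 (c - a) i], and [c - a >= 1]. The
    bound makes the subtraction in [jexp] exact and confines small exponents to small [|j|]. *)
Lemma jexp_quad (c a : nat) (j : int) : (0 < a < c)%N ->
  2 * `|j| <= c%:Z * (j * (j - 1)) + 2 * a%:Z * j.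
Proof.
move=> /andP[a0 ac]; case: (lerP 0 j) => hj.
  rewrite ger0_norm //.
  have : 0 <= c%:Z * (j * (j - 1)).
    case: (eqVneq j 0) => [->|j0]; first by rewrite mul0r mulr0.
    by rewrite mulr_ge0 // mulr_ge0 //; lia.
  by nia.
rewrite ltr0_norm //.
have : 0 <= c%:Z * ((- j) * (- j - 1)).
  by rewrite mulr_ge0 // mulr_ge0 //; lia.
by nia.
Qed.

Lemma jexpK (c a N k : nat) : (0 < a < c)%N -> (k <= 2 * N)%N ->
  (c * 'C(k, 2) + c * N * (2 * N - k) + a * k = jshift c a N + jexp c a N k)%N.
Proof.
move=> ac lek; rewrite /jexp subnKC //.
have := jexp_raw c a lek; have := jexp_quad (k%:Z - N%:Z) ac; lia.
Qed.

Lemma jexpE (c a N k : nat) : (0 < a < c)%N -> (k <= 2 * N)%N ->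
  2 * (jexp c a N k)%:Z =
  c%:Z * ((k%:Z - N%:Z) * (k%:Z - N%:Z - 1)) + 2 * a%:Z * (k%:Z - N%:Z).
Proof.
by move=> ac lek; rewrite -jexp_raw // jexpK // PoszD addrAC subrr add0r.
Qed.

Lemma jexp_ge (c a N k : nat) : (0 < a < c)%N -> (k <= 2 * N)%N ->
  `|k%:Z - N%:Z| <= (jexp c a N k)%:Z.
Proof.
by move=> ac lek; have := jexpE ac lek; have := jexp_quad (k%:Z - N%:Z) ac; lia.
Qed.

Lemma prod_shift (c a N : nat) :
  \prod_(i < N) (- 'X^(a + c * i) : {poly int}) =
  (-1) ^+ N * 'X^(c * 'C(N, 2) + a * N).
Proof.
elim: N => [|N IHN]; first by rewrite big_ord0 !muln0 mulr1.
rewrite big_ord_recr /= IHN.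
have -> : (c * 'C(N.+1, 2) + a * N.+1 = c * 'C(N, 2) + a * N + (a + c * N))%N.
  by rewrite binS bin1; lia.
by rewrite exprS ['X^(_ + (_ + _))]exprD; ring.
Qed.

(* The q-binomial theorem with 2N factors in base X^c; factoring the largest
   monomial out of each factor turns its left-hand side into the truncated
   product of the Jacobi triple product. *)
Lemma finite_jtp (c a N : nat) : (0 < a < c)%N ->
  jprod c a N = \sum_(k < (2 * N).+1)
    (-1) ^+ (N + k) * 'X^(jexp c a N k) * gauss 'X^c (2 * N) k.
Proof.
move=> ac; have Xn0 : ('X^(jshift c a N) : {poly int}) != 0.
  by rewrite expf_neq0 // polyX_eq0.
apply: (mulfI Xn0); have /andP[a0 ltac] := ac.
have : (-1) ^+ N * ('X^(jshift c a N) * jprod c a N) =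
       \prod_(i < 2 * N) ('X^(c * N) + (- 'X^a) * 'X^c ^+ i).
  rewrite mul2n -addnn big_split_ord /=.
  (* In the first [N] factors the monomial of lower degree is [- 'X^(a + c * i)]; in the last [N] it
     is ['X^(c * N)]. *)
  rewrite (eq_bigr (fun i : 'I_N =>
    (- 'X^(a + c * i)) * (1 - 'X^(c * (N - i.+1) + (c - a))))); last first.
    move=> i _; have := ltn_ord i => lti.
    rewrite -exprM mulNr -exprD mulrBr mulr1 !mulNr -exprD opprK addrC.
    congr (- _ + 'X^_).
    have EN : (c * N = c * i + c * (N - i.+1) + c)%N.
      by rewrite -mulnDr -mulnSr; congr (_ * _)%N; lia.
    by rewrite EN; lia.
  rewrite big_split /= prod_shift.
  rewrite [X in _ = _ * X * _](reindex_inj rev_ord_inj) /=.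
  rewrite [X in _ = _ * X * _](eq_bigr (fun i : 'I_N => 1 - 'X^(c * i + (c - a)))); last first.
    by move=> i _; rewrite subnSK ?subKn // ltnW.
  rewrite [X in _ = _ * X](eq_bigr (fun i : 'I_N =>
    'X^(c * N) * (1 - 'X^(c * i + a)))); last first.
    move=> i _; rewrite -exprM mulNr -exprD mulrBr mulr1 -exprD.
    by congr (_ - 'X^_); lia.
  rewrite big_split /= prodr_const card_ord -exprM /jprod big_split /=.
  have -> : 'X^(jshift c a N) = 'X^(c * 'C(N, 2) + a * N) * 'X^(c * N * N)
     :> {poly int}.
    by rewrite -exprD /jshift; congr 'X^_; lia.
  by ring.
rewrite qbinomial => /(congr1 ( *%R ((-1) ^+ N))).
rewrite mulrA -exprD -signr_odd oddD addbb mul1r => ->.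
rewrite !mulr_sumr; apply: eq_bigr => -[k ltk] _ /=; rewrite ltnS in ltk.
rewrite (exprNn 'X^a) -!exprM.
have -> : 'X^(jshift c a N) * ((-1) ^+ (N + k) * 'X^(jexp c a N k) * gauss 'X^c (2 * N) k)
  = (-1) ^+ (N + k) * 'X^(jshift c a N + jexp c a N k) * gauss 'X^c (2 * N) k :> {poly int}.
  by rewrite ['X^(_ + jexp _ _ _ _)]exprD; ring.
by rewrite -jexpK // !exprD; ring.
Qed.

(** * Congruence modulo [X^K] and the truncated theta series *)

Definition eqX (K : nat) (p q : {poly int}) :=
  forall i, (i < K)%N -> p`_i = q`_i.

Lemma eqX_mul K p p' q q' : eqX K p p' -> eqX K q q' -> eqX K (p * q) (p' * q').
Proof.
move=> hp hq i ltiK; rewrite !coefM; apply: eq_bigr => -[j /= ltj] _.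
by rewrite hp ?hq //; apply: leq_ltn_trans ltiK; rewrite ?leq_subr // -ltnS.
Qed.

Lemma eqX_exp K p q n : eqX K p q -> eqX K (p ^+ n) (q ^+ n).
Proof.
by move=> hpq; elim: n => [|n IHn]; rewrite ?expr0 // !exprS; apply: eqX_mul.
Qed.

Lemma qfact_eqX (c n m : nat) : (0 < c)%N -> (n <= m)%N ->
  eqX n.+1 (qfact 'X^c n) (qfact 'X^c m).
Proof.
move=> c0 /subnK <-; elim: (m - n)%N => [|d IHd] i ltin //.
rewrite IHd // addSn qfactS -exprM mulrBr mulr1 coefB coefMXn ifT ?subr0 //.
by apply: leq_trans ltin _; nia.
Qed.

Lemma coef_sign (b : bool) (p : {poly int}) i :
  ((-1) ^+ b * p)`_i = (-1) ^+ b * p`_i.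
Proof. by case: b; rewrite ?mul1r // !mulN1r coefN. Qed.

(** In the [k]-th term, [qfact k * qfact (2N - k)] may replace [qfact (2N) ^ 2] up to the required
    order, and it clears the denominator of the Gaussian binomial, leaving one [qfact (2N)]. *)
Lemma jprod_theta (c a N : nat) : (0 < a < c)%N ->
  eqX N.+1 (jprod c a N * qfact 'X^c (2 * N) ^+ 2)
           (theta c a N * qfact 'X^c (2 * N)).
Proof.
move=> ac i ltiN; rewrite finite_jtp // /theta !mulr_suml !coef_sum.
have c0 : (0 < c)%N by lia.
apply: eq_bigr => -[k /= ltk] _; rewrite ltnS in ltk.
rewrite -!mulrA -(signr_odd _ (N + k)) !coef_sign !coefXnM; case: ltnP => // le_ei.
congr (_ * _); have := jexp_ge ac ltk => geN.
(* The monomial uses up at least [|k - N|] of the degree [i <= N], leaving at most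
   [N - |k - N| = minn k (2N - k)]. To that order [qfact k] and [qfact (2N - k)] both agree with
   [qfact (2N)]. *)
have lei : (i - jexp c a N k < (minn k (2 * N - k)).+1)%N by lia.
rewrite -[in RHS](gauss_qfact _ ltk) -!mulrA expr2.
apply: eqX_mul lei => //; apply: eqX_mul => j ltj; apply/esym.
  by apply: (qfact_eqX c0 (n := k)) => //; lia.
by apply: (qfact_eqX c0 (n := (2 * N - k)%N)); lia.
Qed.

Lemma coefM_1subXn (p : {poly int}) e i :
  (p * (1 - 'X^e))`_i = p`_i - (if (i < e)%N then 0 else p`_(i - e)).
Proof. by rewrite mulrBr mulr1 coefB coefMXn. Qed.

(** * Vanishing of coefficients in a residue class modulo 5 *)

Definition vanishes (r K : nat) (p : {poly int}) :=
  forall i, (i < K)%N -> (i %% 5 = r)%N -> p`_i = 0.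

Lemma vanishes_eqX r K p q : eqX K p q -> vanishes r K p -> vanishes r K q.
Proof. by move=> hpq hp i ltiK ir; rewrite -hpq // hp. Qed.

(** Shifting by [e] preserves residues modulo 5; the factor is cancelled by strong induction on the
    index. *)
Lemma vanishes_1subXn r K p e : (0 < e)%N -> (5 %| e)%N ->
  vanishes r K (p * (1 - 'X^e)) <-> vanishes r K p.
Proof.
move=> e0 e5; split=> hp i; last first.
  move=> ltiK ir; rewrite coefM_1subXn hp // sub0r.
  by case: ltnP => [|lei]; rewrite ?oppr0 // hp ?oppr0 //; lia.
elim/ltn_ind: i => i IHi ltiK ir.
have := hp _ ltiK ir; rewrite coefM_1subXn; case: ltnP => [|lei].
  by rewrite subr0.
by rewrite (IHi (i - e)%N) ?subr0 //; lia.
Qed.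

Lemma vanishes_qfact r K p c n : (0 < c)%N -> (5 %| c)%N ->
  vanishes r K (p * qfact 'X^c n) <-> vanishes r K p.
Proof.
move=> c0 c5; elim: n => [|n IHn]; first by rewrite /qfact big_ord0 mulr1.
rewrite qfactS mulrA -exprM -IHn; apply: vanishes_1subXn; first by rewrite muln_gt0 c0.
by rewrite dvdn_mulr.
Qed.

Lemma vanishes_qfactX r K p c n e : (0 < c)%N -> (5 %| c)%N ->
  vanishes r K (p * qfact 'X^c n ^+ e) <-> vanishes r K p.
Proof.
move=> c0 c5; elim: e => [|e IHe]; first by rewrite mulr1.
by rewrite exprSr mulrA vanishes_qfact.
Qed.

(** * The sign-reversing involution on the fourfold theta series *)

Lemma sum_involution (T : finType) (P : pred T) (h : T -> T) (f : T -> int) :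
  (forall x, P x -> [/\ P (h x), h (h x) = x & f (h x) = - f x]) ->
  \sum_(x | P x) f x = 0.
Proof.
(* Reindexing along [h] makes the sum its own opposite, hence 0 in the integers; at a fixed point of
   [h] the value of [f] is already 0. *)
move=> hP; have : \sum_(x | P x) f x = - \sum_(x | P x) f x.
  rewrite {1}(reindex_onto h h); last by move=> x /hP[].
  rewrite -sumrN; apply: eq_big => [x|x /andP[Phx /eqP hhx]].
    by apply/andP/idP => [[Phx /eqP <-]|/hP[-> -> _] //]; case: (hP _ Phx).
  by have [_ _] := hP _ Phx; rewrite hhx => ->; rewrite opprK.
lia.
Qed.

(* A reflection in the vector (1,1,1,-1) of the quadratic form
   x^2 + y^2 + z^2 + 2 w^2, followed by negation, preserves the shifted lattice
   of exponents as soon as x + y + z - 2 d = -1 modulo 5. *)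
Lemma quad_reflection (a b x y z d K : int) :
  2 * a + b = 5 -> x + y + z - 2 * d = 5 * K - 1 ->
  let Q x y z d := 5 * (x * (x - 1)) + 2 * a * x + (5 * (y * (y - 1)) + 2 * a * y)
    + (5 * (z * (z - 1)) + 2 * a * z) + (10 * (d * (d - 1)) + 2 * b * d) in
  Q (2 * K - x) (2 * K - y) (2 * K - z) (1 - 2 * K - d) = Q x y z d.
Proof.
move=> hb hK /=; have -> : b = 5 - 2 * a by lia.
have -> : x = 5 * K - 1 - y - z + 2 * d by lia.
by ring.
Qed.

Lemma sumM (I J : finType) (F : I -> {poly int}) (G : J -> {poly int}) :
  (\sum_i F i) * (\sum_j G j) = \sum_p F p.1 * G p.2.
Proof. by rewrite big_distrlr pair_bigA. Qed.

Lemma even_consec (j : int) : exists x, j * (j - 1) = 2 * x.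
Proof.
exists (((j %/ 2)%Z) * (2 * (j %/ 2)%Z - 1) + (j %% 2)%Z * 2 * (j %/ 2)%Z).
have [h|h] : (j %% 2)%Z = 0 \/ (j %% 2)%Z = 1 by lia.
all: by rewrite {1 2}(divz_eq j 2) h; ring.
Qed.

Lemma theta_vanishes (a N : nat) : (0 < a < 3)%N ->
  vanishes (5 - a) N.+1 (theta 5 a N ^+ 3 * theta 10 (5 - 2 * a) N).
Proof.
move=> ha m lemN mr.
have ac1 : (0 < a < 5)%N by lia.
have ac2 : (0 < 5 - 2 * a < 10)%N by lia.
pose e := jexp 5 a N; pose e' := jexp 10 (5 - 2 * a) N.
rewrite exprSr expr2 /theta !sumM coef_sum.
rewrite (eq_bigr (fun t : 'I_(2 * N).+1 * 'I_(2 * N).+1 * 'I_(2 * N).+1 * 'I_(2 * N).+1 =>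
   if (e t.1.1.1 + e t.1.1.2 + e t.1.2 + e' t.2 == m)%N
   then (-1) ^+ odd (t.1.1.1 + t.1.1.2 + t.1.2 + t.2) else 0)); last first.
  move=> [[[i j] k] l] _ /=; rewrite -/(e i) -/(e j) -/(e k) -/(e' l).
  (* The four signs [(-1) ^+ N] multiply to 1. *)
  transitivity (((-1) ^+ odd (i + j + k + l) * 'X^(e i + e j + e k + e' l) : {poly int})`_m).
    rewrite signr_odd !exprD.
    apply: (congr1 (fun p : {poly int} => p`_m)).
    transitivity (((-1) ^+ N * (-1) ^+ N) ^+ 2 * ((-1) ^+ i * (-1) ^+ j * (-1) ^+ k * (-1) ^+ l
       * ('X^(e i) * 'X^(e j) * 'X^(e k) * 'X^(e' l))) : {poly int}); first by ring.
    by rewrite -exprD addnn -signr_odd odd_double expr1n; ring.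
  by rewrite coef_sign coefXn eq_sym; case: eqP; rewrite ?mulr1 ?mulr0.
rewrite -big_mkcond /=.
(* With [x = i - N] and likewise for [y], [z], [d], the sum [x + y + z - 2d] is
   [i + j + k - 2l - N]. In indices, the reflection [x |-> n - x] reads [i |-> n - i + 2N], which is
   [r n]. *)
pose K (t : 'I_(2 * N).+1 * 'I_(2 * N).+1 * 'I_(2 * N).+1 * 'I_(2 * N).+1) : int :=
  ((t.1.1.1%:Z + t.1.1.2%:Z + t.1.2%:Z - 2 * t.2%:Z - N%:Z + 1) %/ 5)%Z.
pose r (k : int) (i : 'I_(2 * N).+1) : 'I_(2 * N).+1 := inord (absz (k - i%:Z + 2 * N%:Z)).
apply: (sum_involution (h := fun t => (r (2 * K t)%R t.1.1.1, r (2 * K t)%R t.1.1.2,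
  r (2 * K t)%R t.1.2, r (1 - 2 * K t)%R t.2))) => -[[[i j] k] l] /= /eqP Em.
have /= := (erefl (K (i, j, k, l))); rewrite {1}/K /=.
set K0 := K _ => EK.
have ltN (x : 'I_(2 * N).+1) : (x <= 2 * N)%N by rewrite -ltnS.
have Ei := jexpE ac1 (ltN i); have Ej := jexpE ac1 (ltN j).
have Ek := jexpE ac1 (ltN k); have El := jexpE ac2 (ltN l).
(* Modulo 5 the exponent is [a (x + y + z - 2d)], and it must equal [-a]; both values 1 and 2 of [a]
   are invertible. Writing [x (x - 1)] as an explicit double leaves linear arithmetic. *)
have hK : (i%:Z - N%:Z) + (j%:Z - N%:Z) + (k%:Z - N%:Z) - 2 * (l%:Z - N%:Z) = 5 * K0 - 1.
  move: Em mr; rewrite -/e -/e' in Ei Ej Ek El.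
  have [x Ex] : exists x, (i%:Z - N%:Z) * (i%:Z - N%:Z - 1) = 2 * x by apply: even_consec.
  have [y Ey] : exists x, (j%:Z - N%:Z) * (j%:Z - N%:Z - 1) = 2 * x by apply: even_consec.
  have [z Ez] : exists x, (k%:Z - N%:Z) * (k%:Z - N%:Z - 1) = 2 * x by apply: even_consec.
  rewrite {}Ex {}Ey {}Ez in Ei Ej Ek; set w := _ * _ in El.
  have [a1|a2] : a = 1%N \/ a = 2%N by lia.
    by subst a => Em mr; lia.
  by subst a => Em mr; lia.
have hb : 2 * a%:Z + (5 - 2 * a)%N%:Z = 5 by lia.
have /= hQ := quad_reflection hb hK.
have Em2 : 2 * (e i)%:Z + 2 * (e j)%:Z + 2 * (e k)%:Z + 2 * (e' l)%:Z = 2 * m%:Z by lia.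
rewrite Ei Ej Ek El in Em2; move: hQ; rewrite Em2 => hQ.
(* The four quadratics at the reflected point are nonnegative and sum to [2m <= 2N], so each
   reflected coordinate lies in [[-N, N]] and [inord] does not hit its default. *)
have Qi := jexp_quad (2 * K0 - (i%:Z - N%:Z)) ac1.
have Qj := jexp_quad (2 * K0 - (j%:Z - N%:Z)) ac1.
have Qk := jexp_quad (2 * K0 - (k%:Z - N%:Z)) ac1.
have Ql := jexp_quad (1 - 2 * K0 - (l%:Z - N%:Z)) ac2.
have rE n (x : 'I_(2 * N).+1) : `|n - (x%:Z - N%:Z)| <= N%:Z ->
    (r n x)%:Z = n - x%:Z + 2 * N%:Z.
  by move=> hx; rewrite /r inordK; lia.
have Ri := rE (2 * K0) i; have Rj := rE (2 * K0) j.
have Rk := rE (2 * K0) k; have Rl := rE (1 - 2 * K0) l.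
have {}Ri := Ri ltac:(lia); have {}Rj := Rj ltac:(lia).
have {}Rk := Rk ltac:(lia); have {}Rl := Rl ltac:(lia).
(* The reflected point has the same [K], since [6K - (x + y + z) - 2 (1 - 2K - d) = 5K - 1]; hence
   the map is an involution. *)
have KK : K (r (2 * K0) i, r (2 * K0) j, r (2 * K0) k, r (1 - 2 * K0) l) = K0.
  by rewrite /K /= Ri Rj Rk Rl; lia.
split.
- have := jexpE ac1 (ltN (r (2 * K0) i)); have := jexpE ac1 (ltN (r (2 * K0) j)).
  have := jexpE ac1 (ltN (r (2 * K0) k)); have := jexpE ac2 (ltN (r (1 - 2 * K0) l)).
  rewrite Ri Rj Rk Rl.
  have tr n x : n - x + 2 * N%:Z - N%:Z = n - (x - N%:Z) by ring.
  rewrite !tr -/e -/e' => Tl Tk Tj Ti; apply/eqP; lia.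
- rewrite KK; congr (_, _, _, _); apply/val_inj/eqP; rewrite -eqz_nat /=.
  + by rewrite rE Ri; lia.
  + by rewrite rE Rj; lia.
  + by rewrite rE Rk; lia.
  + by rewrite rE Rl; lia.
(* The 1 in [1 - 2K - d] is the only odd shift, so the parity flips. *)
set n1 := (r _ _ + _ + _ + _)%N; have -> : odd n1 = ~~ odd (i + j + k + l).
  by rewrite /n1; lia.
by case: odd; rewrite ?opprK.
Qed.

(** The value [a = 1] gives the product for [u], and [a = 2] the one for [v]. *)
Definition uvprod (a N : nat) : {poly int} :=
  jprod 5 a N ^+ 3 * jprod 10 (5 - 2 * a) N.

Lemma uvprod_vanishes (a N : nat) : (0 < a < 3)%N ->
  vanishes (5 - a) N.+1 (uvprod a N).
Proof.
move=> ha; have ac1 : (0 < a < 5)%N by lia.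
have ac2 : (0 < 5 - 2 * a < 10)%N by lia.
pose E1 : {poly int} := qfact 'X^5 (2 * N).
pose E2 : {poly int} := qfact 'X^10 (2 * N).
have H := eqX_mul (eqX_exp 3 (jprod_theta (N := N) ac1)) (jprod_theta (N := N) ac2).
(* The exponents 6 and 2 come from [jprod_theta], which supplies a squared [qfact] per triple
   product, with the base-5 one cubed. *)
apply/(@vanishes_qfactX _ _ _ 5 (2 * N) 6 isT isT).
apply/(@vanishes_qfactX _ _ _ 10 (2 * N) 2 isT isT).
rewrite -/E1 -/E2.
have -> : uvprod a N * E1 ^+ 6 * E2 ^+ 2 =
   (jprod 5 a N * E1 ^+ 2) ^+ 3 * (jprod 10 (5 - 2 * a) N * E2 ^+ 2).
  by rewrite /uvprod; ring.
apply: (vanishes_eqX (fun i lti => esym (H i lti))).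
rewrite -/E1 -/E2.
have -> : (theta 5 a N * E1) ^+ 3 * (theta 10 (5 - 2 * a) N * E2) =
   theta 5 a N ^+ 3 * theta 10 (5 - 2 * a) N * E1 ^+ 3 * E2 ^+ 1 by ring.
apply/(@vanishes_qfactX _ _ _ 10 (2 * N) 1 isT isT).
by apply/(@vanishes_qfactX _ _ _ 5 (2 * N) 3 isT isT); exact: theta_vanishes.
Qed.

(** * Recovering integer coefficients from values at small positive reals *)

Definition evalr (R : realType) (p : {poly int}) (r : R) : R :=
  (map_poly intr p).[r].

Section CoefficientsOfLimit.
Variable R : realType.
Local Open Scope classical_set_scope.

Lemma series_coef_poly (p : {poly int}) (r : R) (n : nat) : (size p <= n)%N ->
  series (fun k => (p`_k)%:~R * r ^+ k) n = evalr p r.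
Proof.
move=> lepn; rewrite /evalr (horner_coef_wide (n := n)); last first.
  by apply: leq_trans lepn; exact: size_poly.
by rewrite /series /= big_mkord; apply: eq_bigr => i _; rewrite coef_map.
Qed.

Lemma cvg_terms_bounded (c : nat -> int) (x : R) (l : R) : 
  series (fun n => (c n)%:~R * x ^+ n) @ \oo --> l ->
  exists B : R, 0 <= B /\ forall n, `|(c n)%:~R * x ^+ n| <= B.
Proof.
move=> cl; have /cvg_series_cvg_0 /cvgP : cvgn (series (fun n => (c n)%:~R * x ^+ n)).
  by apply/cvg_ex; exists l.
move/cvg_seq_bounded => [M [_ /(_ (M + 1))]].
rewrite ltrDl ltr01 => /(_ isT) hM; exists (M + 1); split; last by move=> n; exact: hM.
by apply: le_trans (hM 0%N I).
Qed.

(** If all earlier coefficients vanish, [L r = c_m r^m + O(r^(m+1))]; with the bound on [L] this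
    gives [|c_m| <= K r] for all small [r], and an integer of modulus below 1 is 0. *)
Lemma coef_eq0_of_small (c : nat -> int) (N : nat) (C : R) (L : R -> R) :
  0 <= C ->
  (forall r, 0 < r <= 2^-1 ->
     series (fun n => (c n)%:~R * r ^+ n) @ \oo --> L r /\ `|L r| <= C * r ^+ N) ->
  forall m, (m < N)%N -> c m = 0.
Proof.
move=> C0 hL.
have [B [B0 hB]] : exists B : R, 0 <= B /\ forall n, `|(c n)%:~R| <= B * 2 ^+ n.
  have [|h _] := hL 2^-1; first by apply/andP; split; lra.
  have [B [B0 hB]] := cvg_terms_bounded h; exists B; split=> // n.
  have := hB n; rewrite normrM normrX normfV (ger0_norm (_ : 0 <= 2)) //.
  by rewrite exprVn ler_pdivrMr ?exprn_gt0.
move=> m; elim/ltn_ind: m => m IHm ltmN.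
pose K := C + B * 2 ^+ m.+2.
have K0 : 0 <= K by rewrite addr_ge0 // mulr_ge0 // exprn_ge0.
have key r : 0 < r <= 4^-1 -> `|(c m)%:~R| <= K * r.
  move=> /andP[r0 r4]; have [|hr Lr] := hL r; first by apply/andP; split; lra.
  (* A telescoped geometric bound: for [r <= 1/4], [(2r)^n <= 2 ((2r)^n - (2r)^(n+1))]. *)
  have tail n : `|series (fun n => (c n)%:~R * r ^+ n) (m.+1 + n)%N - (c m)%:~R * r ^+ m|
      <= B * 2 * ((2 * r) ^+ m.+1 - (2 * r) ^+ (m.+1 + n)).
    elim: n => [|n IHn].
      rewrite addn0 subrr mulr0 /series /= big_nat_recr //= big_nat big1 ?add0r ?subrr ?normr0 //.
      by move=> i /andP[_ lti]; rewrite IHm ?mul0r // (ltn_trans lti).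
    rewrite addnS /series /= big_nat_recr //= addrAC.
    apply: le_trans (ler_normD _ _) _.
    have hn : `|(c (m.+1 + n)%N)%:~R * r ^+ (m.+1 + n)| <= B * (2 * r) ^+ (m.+1 + n).
      rewrite normrM (ger0_norm (exprn_ge0 _ (ltW r0))) exprMn mulrA.
      by rewrite ler_wpM2r ?exprn_ge0 // ltW.
    have p0 : 0 <= B * (2 * r) ^+ (m.+1 + n).
      by rewrite mulr_ge0 // exprn_ge0 //; lra.
    rewrite [(2 * r) ^+ (_ + _).+1]exprS.
    have r4' : 0 <= 4^-1 - r by lra.
    have := mulr_ge0 p0 r4'; move: hn; have := IHn; rewrite /series /=.
    set s := (2 * r) ^+ (m.+1 + n); set t := (2 * r) ^+ m.+1.
    move=> h1 h2 h3; apply: le_trans (lerD h1 h2) _; lra.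
  have hl : `|L r - (c m)%:~R * r ^+ m| <= B * 2 * (2 * r) ^+ m.+1.
    have cv : `|series (fun n => (c n)%:~R * r ^+ n) n - (c m)%:~R * r ^+ m| @[n --> \oo]
         --> `|L r - (c m)%:~R * r ^+ m|.
      by apply: cvg_norm; apply: cvgB => //; exact: cvg_cst.
    apply: (cvgr_to_le cv); exists m.+1 => // n /= lemn.
    rewrite -(subnKC lemn); apply: le_trans (tail _) _.
    by rewrite ler_wpM2l ?mulr_ge0 // gerBl exprn_ge0 //; lra.
  have rm : 0 < r ^+ m by exact: exprn_gt0.
  have hN : r ^+ N <= r ^+ m.+1 by apply: ler_wiXn2l => //; lra.
  rewrite -(ler_pM2r rm) -{1}(ger0_norm (ltW rm)) -normrM.
  apply: (@le_trans _ _ (`|L r - (c m)%:~R * r ^+ m| + `|L r|)).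
    by rewrite -[X in `|X| <= _](subKr (L r)) [leRHS]addrC ler_normB.
  apply: le_trans (lerD hl Lr) _.
  apply: (@le_trans _ _ (B * 2 * (2 * r) ^+ m.+1 + C * r ^+ m.+1)).
    by rewrite lerD2l ler_wpM2l.
  by rewrite /K exprMn !exprS le_eqVlt; apply/orP; left; apply/eqP; ring.
(* This choice gives both [r <= 1/4] and [K r < 1]. *)
pose r := (4 + K)^-1.
have r0 : 0 < r by rewrite invr_gt0; lra.
have : `|(c m)%:~R : R| < 1.
  apply: le_lt_trans (key r _) _; last by rewrite ltr_pdivrMr; lra.
  by rewrite r0 lef_pV2 ?posrE; lra.
by rewrite -intr_norm ltrz1; lia.
Qed.

Lemma coef_of_limit (u : nat -> int) (P : nat -> {poly int}) (C : R) (N : nat) :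
  0 <= C ->
  (forall r : R, 0 < r <= 2^-1 -> exists l : R,
     [/\ series (fun n => (u n)%:~R * r ^+ n) @ \oo --> l,
         (fun n => evalr (P n) r) @ \oo --> l
       & forall n, (N <= n)%N -> `|evalr (P n) r - evalr (P N) r| <= C * r ^+ N]) ->
  forall m, (m < N)%N -> u m = (P N)`_m.
Proof.
move=> C0 hP m ltmN; apply/eqP; rewrite -subr_eq0; apply/eqP.
(* [xget] turns the pointwise limits into a function of [r]; its default 0 does not occur for
   [0 < r <= 1/2]. *)
pose L r := xget 0 [set l : R | series (fun n => (u n)%:~R * r ^+ n) @ \oo --> l]
   - evalr (P N) r.
apply: (@coef_eq0_of_small (fun n => u n - (P N)`_n) N C L C0 _ m ltmN) => r hr.
have [l [cu cP hl]] := hP r hr.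
have EL : L r = l - evalr (P N) r.
  rewrite /L; case: xgetP => [y _ /= cy|/(_ l) //]; congr (_ - _).
  exact: (cvg_unique (@norm_hausdorff _ _) cy cu).
rewrite EL; split.
  have -> : series (fun n => (u n - (P N)`_n)%:~R * r ^+ n) =
      (fun n => series (fun n => (u n)%:~R * r ^+ n) n
        - series (fun n => ((P N)`_n)%:~R * r ^+ n) n).
    apply/funext => n; rewrite /series /= -sumrB; apply: eq_bigr => i _.
    by rewrite intrB mulrBl.
  apply: cvgB => //; apply: cvg_near_cst.
  by exists (size (P N)) => // n /= le_n; rewrite series_coef_poly.
have cv : `|evalr (P n) r - evalr (P N) r| @[n --> \oo] --> `|l - evalr (P N) r|.
  by apply: cvg_norm; apply: cvgB => //; exact: cvg_cst.
by apply: (cvgr_to_le cv); exists N => // n /= leNn; exact: hl.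
Qed.

End CoefficientsOfLimit.

(** * Convergence rate of the truncated products *)

Section ProductBounds.
Variable R : realType.

Definition near1 (s x : R) := [/\ 0 <= x, x <= 1 & 1 - s <= x].

(** Distances to 1 add, because [(1 - x) (1 - y) >= 0]. *)
Lemma near1M s t x y : near1 s x -> near1 t y -> near1 (s + t) (x * y).
Proof.
move=> [x0 x1 xs] [y0 y1 yt]; split; first exact: mulr_ge0.
  by rewrite mulr_ile1.
have : 0 <= (1 - x) * (1 - y) by rewrite mulr_ge0 // subr_ge0.
by lra.
Qed.

Lemma near1_1subX (r : R) (k e : nat) : 0 < r <= 2^-1 -> (k <= e)%N ->
  near1 (r ^+ k) (1 - r ^+ e).
Proof.
move=> /andP[r0 r2] ke.
have : r ^+ e <= r ^+ k by apply: ler_wiXn2l => //; lra.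
have : r ^+ e <= 1 by apply: exprn_ile1; lra.
have : 0 <= r ^+ e by rewrite exprn_ge0 // ltW.
by move=> *; split; lra.
Qed.

Lemma evalrM p q (r : R) : evalr (p * q) r = evalr p r * evalr q r.
Proof. by rewrite /evalr rmorphM hornerM. Qed.

Lemma evalrX p n (r : R) : evalr (p ^+ n) r = evalr p r ^+ n.
Proof. by rewrite /evalr rmorphXn horner_exp. Qed.

Lemma evalr1 (r : R) : evalr 1 r = 1.
Proof. by rewrite /evalr rmorph1 hornerC. Qed.

Lemma evalr_1subXn e (r : R) : evalr (1 - 'X^e) r = 1 - r ^+ e.
Proof. by rewrite /evalr rmorphB /= rmorph1 map_polyXn !hornerE. Qed.

(** Each step adds eight factors, six from the cube and two from the base-10 product, all with
    exponent at least [n]. *)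
Lemma uvprod_step (a n : nat) (r : R) : 0 < r <= 2^-1 ->
  exists2 g, evalr (uvprod a n.+1) r = evalr (uvprod a n) r * g
    & near1 (8 * r ^+ n) g.
Proof.
move=> hr; rewrite /uvprod /jprod !big_ord_recr /= !(evalrM, evalrX) !evalr_1subXn.
set x1 := 1 - r ^+ (5 * n + a); set x2 := 1 - r ^+ _.
set x3 := 1 - r ^+ _; set x4 := 1 - r ^+ _.
exists ((x1 * x2) * (x1 * x2) * (x1 * x2) * (x3 * x4)); first by ring.
have h e : (n <= e)%N -> near1 (r ^+ n) (1 - r ^+ e) by exact: near1_1subX.
have h1 : near1 (r ^+ n) x1 by apply: h; lia.
have h2 : near1 (r ^+ n) x2 by apply: h; lia.
have h3 : near1 (r ^+ n) x3 by apply: h; lia.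
have h4 : near1 (r ^+ n) x4 by apply: h; lia.
have -> : 8 * r ^+ n = (r ^+ n + r ^+ n) + (r ^+ n + r ^+ n) + (r ^+ n + r ^+ n)
  + (r ^+ n + r ^+ n) by ring.
by do 4!apply: near1M => //; exact: near1M.
Qed.

Lemma uvprod_bound (a N n : nat) (r : R) : 0 < r <= 2^-1 -> (N <= n)%N ->
  `|evalr (uvprod a n) r - evalr (uvprod a N) r| <= 16 * r ^+ N.
Proof.
move=> hr; have /andP[r0 r2] := hr.
have P01 k : 0 <= evalr (uvprod a k) r <= 1.
  elim: k => [|k /andP[IH0 IH1]].
    by rewrite /uvprod /jprod !big_ord0 expr1n mulr1 evalr1 ler01 lexx.
  have [g -> [g0 g1 _]] := uvprod_step a k hr.
  by rewrite mulr_ge0 //= mulr_ile1.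
move=> /subnKC <-; set d := (n - N)%N.
(* Since [r <= 1/2], each loss [8 r^n] is at most [16 (r^n - r^(n+1))], which telescopes. *)
have : 0 <= evalr (uvprod a N) r - evalr (uvprod a (N + d)) r
   <= 16 * (r ^+ N - r ^+ (N + d)).
  elim: d => [|d /andP[IH1 IH2]]; first by rewrite addn0 !subrr mulr0 lexx.
  rewrite addnS; have [g -> [g0 g1 gs]] := uvprod_step a (N + d) hr.
  have /andP[p0 p1] := P01 (N + d)%N.
  set p := evalr (uvprod a (N + d)) r in IH1 IH2 p0 p1 *.
  have h1 : 0 <= p * (1 - g) by rewrite mulr_ge0 // subr_ge0.
  have h2 : p * (1 - g) <= 1 - g by rewrite ler_piMl // subr_ge0.
  have rn : 0 <= r ^+ (N + d) by rewrite exprn_ge0 // ltW.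
  have h3 : 0 <= r ^+ (N + d) * (2^-1 - r) by rewrite mulr_ge0 // subr_ge0.
  by rewrite exprS; apply/andP; split; lra.
have rn : 0 <= r ^+ (N + d) by rewrite exprn_ge0 // ltW.
by move=> /andP[h1 h2]; rewrite distrC ger0_norm //; lra.
Qed.

End ProductBounds.

(** * Transfer from complex expansions to real points *)

Section RealPoints.
Variable R : realType.
Local Open Scope classical_set_scope.

Definition toC : R -> cplx R := real_complex R.

HB.instance Definition _ := GRing.RMorphism.on toC.

Lemma norm_toC (x : R) : `|toC x| = toC `|x|.
Proof.
rewrite [LHS]normc_def /= expr0n /= addr0 sqrtr_sqr.
by [].
Qed.

(** The embedding is isometric, and a positive element of the complex order is real, so the same
    radii serve on both sides. *)
Lemma cvg_toC (f : nat -> R) (l : R) :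
  (fun n => toC (f n)) @ \oo --> toC l <-> f @ \oo --> l.
Proof.
split=> /cvgrPdist_lt h; apply/cvgrPdist_lt => e e0.
  have /h : 0 < toC e by rewrite ltcR.
  by apply: filterS => n; rewrite -rmorphB norm_toC ltcR.
have /RRe_real Ee : e \is Num.real by exact: gtr0_real.
have /h : 0 < complex.Re e by rewrite -ltcR Ee.
by apply: filterS => n; rewrite -rmorphB norm_toC -ltcR Ee.
Qed.

(** The partial products are nonincreasing and nonnegative, so the [lim] in [qpoch] is a genuine
    limit. *)
Lemma qpoch_toC (a q : R) : 0 <= a <= 1 -> 0 <= q <= 1 ->
  exists2 l : R, qpoch (toC a) (toC q) = toC l
    & (fun n => \prod_(k < n) (1 - a * q ^+ k)) @ \oo --> l.
Proof.
move=> /andP[a0 a1] /andP[q0 q1].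
have b k : 0 <= 1 - a * q ^+ k <= 1.
  have : 0 <= a * q ^+ k by rewrite mulr_ge0 ?exprn_ge0.
  have : a * q ^+ k <= 1 by rewrite mulr_ile1 ?exprn_ge0 ?exprn_ile1.
  by move=> *; apply/andP; split; lra.
pose f n := \prod_(k < n) (1 - a * q ^+ k).
have f0 n : 0 <= f n by apply: prodr_ge0 => k _; case/andP: (b k).
have cf : cvgn f.
  apply: nonincreasing_is_cvgn.
    apply/nonincreasing_seqP => n; rewrite /f big_ord_recr /= ler_piMr ?f0 //.
    by case/andP: (b n).
  by exists 0 => _ [n _ <-].
exists (lim (f @ \oo)) => //; rewrite /qpoch; apply: cvg_lim.
  exact: norm_hausdorff.
have -> : (fun n => \prod_(k < n) (1 - toC a * toC q ^+ k)) = (fun n => toC (f n)).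
  apply/funext => n; rewrite /f rmorph_prod; apply: eq_bigr => k _.
  by rewrite rmorphB rmorph1 rmorphM rmorphXn.
by apply/cvg_toC.
Qed.

Lemma qpochs_toC (c a : nat) (r : R) : (a <= c)%N -> 0 <= r <= 1 ->
  exists2 l : R, qpochs [:: toC r ^+ a; toC r ^+ (c - a)] (toC r ^+ c) = toC l
    & (fun n => evalr (jprod c a n) r) @ \oo --> l.
Proof.
move=> leac /andP[r0 r1].
have h e : 0 <= r ^+ e <= 1 by rewrite exprn_ge0 ?exprn_ile1.
have [l1 E1 c1] := qpoch_toC (h a) (h c).
have [l2 E2 c2] := qpoch_toC (h (c - a)%N) (h c).
exists (l1 * l2).
  by rewrite /qpochs big_cons big_seq1 -!rmorphXn E1 E2 rmorphM.
have -> : (fun n => evalr (jprod c a n) r) = 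
   (fun n => (\prod_(k < n) (1 - r ^+ a * (r ^+ c) ^+ k))
      * (\prod_(k < n) (1 - r ^+ (c - a) * (r ^+ c) ^+ k))).
  apply/funext => n; rewrite /jprod; elim: n => [|n IHn].
    by rewrite !big_ord0 evalr1 mulr1.
  rewrite !big_ord_recr /= evalrM IHn evalrM !evalr_1subXn !exprD -!exprM.
  by ring.
exact: cvgM.
Qed.

Lemma qexpansion_coef (a : nat) (u : nat -> int) : (0 < a < 3)%N ->
  has_qexpansion u (fun q : cplx R =>
    qpochs [:: q ^+ a; q ^+ (5 - a)] (q ^+ 5) ^+ 3
    * qpochs [:: q ^+ (5 - 2 * a); q ^+ (10 - (5 - 2 * a))] (q ^+ 10)) ->
  forall m, (m %% 5 = 5 - a)%N -> u m = 0.
Proof.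
move=> ha hu m mr; transitivity (uvprod a m.+1)`_m; last first.
  exact: (uvprod_vanishes ha) mr.
(* Truncation at [m + 1] already determines the [m]-th coefficient; 16 is the constant of
   [uvprod_bound]. *)
apply: (@coef_of_limit R u (uvprod a) 16 m.+1) => // r hr.
have /andP[r0 r2] := hr.
have r01 : 0 <= r <= 1 by apply/andP; split; lra.
have [l1 E1 c1] := @qpochs_toC 5 a r ltac:(lia) r01.
have [l2 E2 c2] := @qpochs_toC 10 (5 - 2 * a) r ltac:(lia) r01.
exists (l1 ^+ 3 * l2); split; last by move=> n; exact: uvprod_bound.
- apply/cvg_toC; rewrite rmorphM rmorphXn /= -E1 -E2.
  have r1 : `|toC r| < 1 by rewrite norm_toC -(rmorph1 toC) ltcR ger0_norm; lra.
  have -> : (fun n => toC (series (fun n => (u n)%:~R * r ^+ n) n)) =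
     series (fun n => (u n)%:~R * toC r ^+ n).
    apply/funext => n; rewrite /series /= rmorph_sum; apply: eq_bigr => i _.
    by rewrite rmorphM rmorphXn rmorph_int.
  exact: hu.
have -> : (fun n => evalr (uvprod a n) r) = 
   (fun n => evalr (jprod 5 a n) r ^+ 3 * evalr (jprod 10 (5 - 2 * a) n) r).
  by apply/funext => n; rewrite evalrM evalrX.
apply: cvgM => //.
have -> : (fun n => evalr (jprod 5 a n) r ^+ 3) = 
   (fun n => evalr (jprod 5 a n) r * (evalr (jprod 5 a n) r * evalr (jprod 5 a n) r)).
  by apply/funext => n; rewrite exprS expr2.
by rewrite exprS expr2; apply: cvgM => //; exact: cvgM.
Qed.

End RealPoints.

Theorem theorem14 (R : realType) (u v : nat -> int)
  (hu : has_qexpansion u (fun q : cplx R =>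
          qpochs [:: q; q ^+ 4] (q ^+ 5) ^+ 3
          * qpochs [:: q ^+ 3; q ^+ 7] (q ^+ 10)))
  (hv : has_qexpansion v (fun q : cplx R =>
          qpochs [:: q ^+ 2; q ^+ 3] (q ^+ 5) ^+ 3
          * qpochs [:: q; q ^+ 9] (q ^+ 10))) :
  (forall n : nat, u (5 * n + 4)%N = 0) /\
  (forall n : nat, v (5 * n + 3)%N = 0).
Proof.
split=> n.
  by apply: (@qexpansion_coef R 1 u isT hu); lia.
by apply: (@qexpansion_coef R 2 v isT hv); lia.
Qed.
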